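(* For all integers $k\ge1$, $$\frac{\sqrt{2\pi}\,e^{\frac{1}{12k+1}-\frac{1}{8k}}}{6(k+1)^{3/2}} \le \Delta_{k+1} \le \frac{\sqrt{2\pi}\,e^{\frac{1}{12k}}}{6k^{3/2}}.$$
   Context: The Stieltjes partial approximation error is, for real $x>e$, $$\Delta(x) = \int_{e^{n}}^{x}\frac{n!}{\ln^{n+1}(t)}\,dt - \frac{(\ln(x)-n)\,x\,n!}{\ln^{n+1}(x)}, \qquad n=\lceil\ln(x)\rceil-1,$$ where $\ln^m(x)$ means $(\ln x)^m$, and $\Delta_k=\Delta(e^k)$ for integers $k\ge2$ (so for $x=e^k$ one has $n=k-1$). *)

(* Defs.v *)
From Stdlib Require Import Reals ZArith Arith Zfloor.
From Coquelicot Require Import Coquelicot.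
Open Scope R_scope.

(* [Z.to_nat] truncates nothing in the range of interest: for x > e the
   integer ceil (ln x) - 1 is at least 1.  For x <= e the definitions below
   carry no meaning. *)
Definition stieltjes_n (x : R) : nat := Z.to_nat (Zceil (ln x) - 1).

(* [RInt] is total; for x > e the integrand is continuous on [e^n, x], as
   e^n > 1 there. *)
Definition Delta (x : R) : R :=
  let n := stieltjes_n x in
  RInt (fun t : R => INR (fact n) / (ln t) ^ (n + 1)) (exp (INR n)) x
  - (ln x - INR n) * x * INR (fact n) / (ln x) ^ (n + 1).

(* Meant for k >= 2, so that e^k > e. *)
Definition Delta_int (k : nat) : R := Delta (exp (INR k)).

(* Main.v *)
(** With t = e^s, an integration by parts turns Delta_(k+1) into
    k! times the integral over [k, k+1] of (s - k) (k + 1 - s) e^s / s^(k+2).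
    The factor e^s / s^(k+2) is decreasing there and the quadratic weight
    integrates to 1/6, so Delta_(k+1) lies between (k!/6) e^(k+1) / (k+1)^(k+2)
    and (k!/6) e^k / k^(k+2).  The upper bound is then Stirling's formula with
    Robbins' error term 1/(12k); the lower bound is the plain Stirling lower
    bound for (k+1)!, because the exponent 1/(12k+1) - 1/(8k) is negative. *)

Require Import Defs.
From Stdlib Require Import Reals Lra Lia ZArith Zfloor.
From Coquelicot Require Import Coquelicot.
Open Scope R_scope.

(** * Monotonicity of e^s / s^p for 0 < s <= p *)

Lemma exp_nondecreasing (x y : R) : x <= y -> exp x <= exp y.
Proof.
  intros [H | ->]; [left; apply exp_increasing; exact H | apply Rle_refl].
Qed.

(** From 1 - u <= e^(-u) with u = (r - s) / r one gets e^u <= r / s. Raising this to the power p >=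
    r gives e^(r - s) <= (r / s)^p, without differentiation. *)
Lemma exp_div_pow_decreasing (p : nat) (s r : R) :
  0 < s -> s <= r -> r <= INR p -> exp r / r ^ p <= exp s / s ^ p.
Proof.
  intros Hs Hsr Hrp.
  assert (Hp : 0 < INR p) by lra.
  assert (Hrs : 1 <= r / s) by (apply Rle_div_r; lra).
  assert (Hq : exp ((r - s) / r) <= r / s).
  { replace (r / s) with (/ (s / r)) by (field; lra).
    rewrite <- (Rinv_inv (exp _)), <- exp_Ropp.
    apply Rinv_le_contravar; [apply Rdiv_lt_0_compat; lra |].
    replace (s / r) with (1 + - ((r - s) / r)) by (field; lra).
    apply exp_ineq1_le. }
  assert (Hpow : exp (r - s) <= (r / s) ^ p).
  { apply Rle_trans with (exp ((r - s) / r) ^ p).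
    - rewrite <- Rpower_pow by apply exp_pos. unfold Rpower. rewrite ln_exp. apply exp_nondecreasing.
      apply Rle_trans with (r * ((r - s) / r)).
      + right. field. lra.
      + apply Rmult_le_compat_r; [| lra]. apply Rdiv_le_0_compat; lra.
    - apply pow_incr. split; [left; apply exp_pos | exact Hq]. }
  assert (Hsp : 0 < s ^ p) by (apply pow_lt; lra).
  assert (Hrp' : 0 < r ^ p) by (apply pow_lt; lra).
  apply Rle_div_l; [lra |].
  replace r with (s + (r - s)) at 1 by ring.
  rewrite exp_plus.
  replace (exp s / s ^ p * r ^ p) with (exp s * (r / s) ^ p).
  - apply Rmult_le_compat_l; [left; apply exp_pos | exact Hpow].
  - unfold Rdiv at 1. rewrite Rpow_mult_distr, pow_inv. field. lra.
Qed.

(** * Reduction of [Delta_int] to bounds on e^s / s^(k+2) *)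

Lemma ln_interval (a b t : R) :
  exp a <= t <= exp b -> 0 < t /\ a <= ln t <= b.
Proof.
  intros [H1 H2].
  assert (0 < t) by (pose proof (exp_pos a); lra).
  split; [assumption |].
  rewrite <- (ln_exp a) at 1. rewrite <- (ln_exp b).
  split; apply ln_le; auto using exp_pos.
Qed.

Lemma ex_RInt_inv_ln_pow (m : nat) (a b : R) :
  0 < a -> a <= b -> ex_RInt (fun t => / ln t ^ m) (exp a) (exp b).
Proof.
  intros Ha Hab. apply (ex_RInt_continuous (V := R_CompleteNormedModule)).
  intros t Ht.
  rewrite Rmin_left, Rmax_right in Ht by (apply exp_nondecreasing; lra).
  apply ln_interval in Ht as [Ht Hl].
  apply (ex_derive_continuous (V := R_NormedModule)). auto_derive.
  repeat split; try lra. apply pow_nonzero; lra.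
Qed.

(* The integration by parts and the substitution t = e^s are both absorbed in an
   explicit antiderivative: the first summand is the derivative of
   (ln t - n) t / ln^(n+1) t, and the second has integral c/6.  It lies above or
   below 1 / ln^(n+1) t according to how c compares with t / ln^(n+2) t. *)
Definition parts_integrand (n : nat) (c t : R) : R :=
  (/ ln t ^ (n + 1) - (ln t - INR n) * (INR n + 1 - ln t) / ln t ^ (n + 2))
  + c * ((ln t - INR n) * (INR n + 1 - ln t) / t).

Lemma is_RInt_parts_integrand (n : nat) (c : R) :
  (1 <= n)%nat ->
  is_RInt (parts_integrand n c) (exp (INR n)) (exp (INR n + 1))
    (exp (INR n + 1) / (INR n + 1) ^ (n + 1) + c / 6).
Proof.
  intros Hn.
  assert (Hn1 : 1 <= INR n) by (apply (le_INR 1); lia).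
  (* The first summand vanishes where ln t = n and yields the boundary term where ln t = n + 1. The
     cubic in ln t - n rises by 1/2 - 1/3 = 1/6. *)
  set (F := fun t => (ln t - INR n) * t / ln t ^ (n + 1)
    + c * ((ln t - INR n) ^ 2 / 2 - (ln t - INR n) ^ 3 / 3)).
  replace (exp (INR n + 1) / (INR n + 1) ^ (n + 1) + c / 6)
    with (minus (F (exp (INR n + 1))) (F (exp (INR n)))).
  2: { unfold F, minus, plus, opp; simpl Rplus. cbn -[pow]. rewrite !ln_exp. field.
       split; apply pow_nonzero; lra. }
  apply (is_RInt_derive (V := R_CompleteNormedModule)); intros t Ht;
    rewrite Rmin_left, Rmax_right in Ht by (apply exp_nondecreasing; lra);
    apply ln_interval in Ht as [Ht Hl];
    assert (Hp : ln t ^ n <> 0) by (apply pow_nonzero; lra).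
  - unfold F, parts_integrand. auto_derive.
    + repeat split; try lra. apply pow_nonzero; lra.
    + replace (Init.Nat.pred (n + 1)) with n by lia.
      rewrite plus_INR, !pow_add. simpl. field. repeat split; lra.
  - apply (ex_derive_continuous (V := R_NormedModule)).
    unfold parts_integrand. auto_derive.
    repeat split; try lra; apply pow_nonzero; lra.
Qed.

Lemma Delta_int_succ (k : nat) :
  (1 <= k)%nat ->
  Delta_int (k + 1) = INR (fact k) *
    (RInt (fun t => / ln t ^ (k + 1)) (exp (INR k)) (exp (INR k + 1))
     - exp (INR k + 1) / (INR k + 1) ^ (k + 1)).
Proof.
  intros Hk.
  assert (Hn1 : 1 <= INR k) by (apply (le_INR 1); lia).
  (* ln x is here the integer k + 1, its own ceiling, so n = k and the factor ln x - n equals 1. *)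
  assert (Hn : stieltjes_n (exp (INR (k + 1))) = k).
  { unfold stieltjes_n. rewrite ln_exp.
    rewrite (Zceil_eq (Z.of_nat (k + 1))) by (rewrite <- INR_IZR_INZ; lra). lia. }
  unfold Delta_int, Defs.Delta. cbv zeta. rewrite Hn, ln_exp.
  replace (INR (k + 1)) with (INR k + 1) by (rewrite plus_INR; reflexivity).
  assert (E : RInt (fun t => INR (fact k) / ln t ^ (k + 1)) (exp (INR k)) (exp (INR k + 1))
    = INR (fact k) * RInt (fun t => / ln t ^ (k + 1)) (exp (INR k)) (exp (INR k + 1))).
  { apply (RInt_scal (V := R_CompleteNormedModule)).
    apply ex_RInt_inv_ln_pow; lra. }
  rewrite E. field. apply pow_nonzero; lra.
Qed.

(** The integrand is squeezed between [parts_integrand] for two values of c, the extreme values of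
    e^s / s^(k+2) on [k, k+1]. The boundary term of [Delta_int_succ] cancels and leaves c / 6. *)
Lemma Delta_int_bounds (k : nat) :
  (1 <= k)%nat ->
  INR (fact k) / 6 * (exp (INR k + 1) / (INR k + 1) ^ (k + 2))
  <= Delta_int (k + 1)
  <= INR (fact k) / 6 * (exp (INR k) / INR k ^ (k + 2)).
Proof.
  intros Hk. rewrite Delta_int_succ by assumption.
  assert (Hn1 : 1 <= INR k) by (apply (le_INR 1); lia).
  assert (Hf : 0 < INR (fact k)) by apply INR_fact_lt_0.
  assert (Hexp : exp (INR k) <= exp (INR k + 1)) by (apply exp_nondecreasing; lra).
  pose proof (fun c => is_RInt_parts_integrand k c Hk) as HI.
  pose proof (ex_RInt_inv_ln_pow (k + 1) (INR k) (INR k + 1) ltac:(lra) ltac:(lra)) as Hex.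
  set (hi := exp (INR k) / INR k ^ (k + 2)).
  set (lo := exp (INR k + 1) / (INR k + 1) ^ (k + 2)).
  assert (Hpt : forall t, exp (INR k) < t < exp (INR k + 1) ->
    parts_integrand k lo t <= / ln t ^ (k + 1) <= parts_integrand k hi t).
  { intros t Ht.
    destruct (ln_interval (INR k) (INR k + 1) t) as [Ht0 Hl]; [lra |].
    assert (Hk2 : INR (k + 2) = INR k + 2) by (rewrite plus_INR; reflexivity).
    pose proof (exp_div_pow_decreasing (k + 2) (ln t) (INR k + 1)
      ltac:(lra) ltac:(lra) ltac:(lra)) as H1.
    pose proof (exp_div_pow_decreasing (k + 2) (INR k) (ln t)
      ltac:(lra) ltac:(lra) ltac:(lra)) as H2.
    rewrite exp_ln in H1, H2 by assumption. fold hi in H2. fold lo in H1.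
    assert (Hw : 0 <= (ln t - INR k) * (INR k + 1 - ln t) / t).
    { apply Rdiv_le_0_compat; [apply Rmult_le_pos; lra | lra]. }
    assert (Hp : ln t ^ (k + 2) <> 0) by (apply pow_nonzero; lra).
    unfold parts_integrand.
    (* Both sides become multiples of the same nonnegative weight [Hw], so only the coefficients t /
       ln^(k+2) t and c are compared. *)
    replace ((ln t - INR k) * (INR k + 1 - ln t) / ln t ^ (k + 2))
      with (t / ln t ^ (k + 2) * ((ln t - INR k) * (INR k + 1 - ln t) / t))
      by (field; lra).
    split; nra. }
  pose proof (RInt_le _ _ _ _ Hexp (ex_intro _ _ (HI lo)) Hex
    (fun t Ht => proj1 (Hpt t Ht))) as H1.
  pose proof (RInt_le _ _ _ _ Hexp Hex (ex_intro _ _ (HI hi))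
    (fun t Ht => proj2 (Hpt t Ht))) as H2.
  rewrite (is_RInt_unique _ _ _ _ (HI lo)) in H1.
  rewrite (is_RInt_unique _ _ _ _ (HI hi)) in H2.
  split; nra.
Qed.

(** * Logarithm inequalities and Robbins' telescoping bounds *)

Lemma nonneg_of_nonneg_derive (f df : R -> R) (y : R) :
  f 0 = 0 -> 0 <= y ->
  (forall x, 0 <= x <= y -> is_derive f x (df x) /\ 0 <= df x) -> 0 <= f y.
Proof.
  intros H0 Hy H.
  destruct (MVT_gen f 0 y df) as [c [Hc E]];
    rewrite ?Rmin_left, ?Rmax_right in * by lra.
  - intros x Hx. apply H; lra.
  - intros x Hx. apply derivable_continuous_pt. exists (df x).
    apply is_derive_Reals, H; lra.
  - destruct (H c Hc) as [_ Hd]. rewrite H0 in E. nra.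
Qed.

Lemma ln_1p_lower (y : R) : 0 <= y -> 2 * y / (2 + y) <= ln (1 + y).
Proof.
  intros Hy.
  enough (0 <= ln (1 + y) - 2 * y / (2 + y)) by lra.
  apply (nonneg_of_nonneg_derive (fun y => ln (1 + y) - 2 * y / (2 + y))
    (fun x => x ^ 2 / ((1 + x) * (2 + x) ^ 2))); [| exact Hy |].
  - rewrite !Rplus_0_r, ln_1. field.
  - intros x Hx. split.
    + auto_derive; [lra |]. field. lra.
    + apply Rdiv_le_0_compat; [apply pow2_ge_0 |].
      apply Rmult_lt_0_compat; [lra | apply pow_lt; lra].
Qed.

(** At y = 1/n the factor 2y / (2 + y) is 1 / (n + 1/2), and the correction is 1 / (12 n (n + 1)),
    which telescopes. *)
Lemma ln_1p_upper (y : R) :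
  0 <= y -> ln (1 + y) <= 2 * y / (2 + y) * (1 + y ^ 2 / (12 * (1 + y))).
Proof.
  intros Hy.
  enough (0 <= 2 * y / (2 + y) * (1 + y ^ 2 / (12 * (1 + y))) - ln (1 + y)) by lra.
  apply (nonneg_of_nonneg_derive
    (fun y => 2 * y / (2 + y) * (1 + y ^ 2 / (12 * (1 + y))) - ln (1 + y))
    (fun x => x ^ 4 / (6 * (1 + x) ^ 2 * (2 + x) ^ 2))); [| exact Hy |].
  - rewrite !Rplus_0_r, ln_1. field.
  - intros x Hx. split.
    + auto_derive; [lra |]. field. lra.
    + apply Rdiv_le_0_compat; [apply pow_le; lra |].
      repeat apply Rmult_lt_0_compat; try apply pow_lt; lra.
Qed.

(** Logarithm of n! / (n^(n + 1/2) e^(-n)), whose limit is ln (2 pi) / 2. *)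
Definition stirling_defect (n : nat) : R :=
  ln (INR (fact n)) - (INR n + / 2) * ln (INR n) + INR n.

(** The difference equals (n + 1/2) ln (1 + 1/n) - 1, to which the two logarithm bounds apply at y =
    1/n. *)
Lemma stirling_defect_step (n : nat) :
  (1 <= n)%nat ->
  0 <= stirling_defect n - stirling_defect (S n)
    <= 1 / (12 * INR n) - 1 / (12 * INR (S n)).
Proof.
  intros Hn.
  assert (Hn1 : 1 <= INR n) by (apply (le_INR 1); lia).
  assert (Hy : 0 <= / INR n) by (left; apply Rinv_0_lt_compat; lra).
  assert (E : stirling_defect n - stirling_defect (S n)
    = (INR n + / 2) * ln (1 + / INR n) - 1).
  { unfold stirling_defect.
    replace (1 + / INR n) with (INR (S n) / INR n) by (rewrite S_INR; field; lra).
    rewrite fact_simpl, mult_INR, ln_mult, ln_div, S_INR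
      by (try apply INR_fact_lt_0; rewrite ?S_INR; lra).
    field. }
  rewrite E, S_INR.
  pose proof (ln_1p_lower _ Hy) as H1. pose proof (ln_1p_upper _ Hy) as H2.
  split.
  - replace 1 with ((INR n + / 2) * (2 * / INR n / (2 + / INR n))) at 2
      by (field; lra).
    nra.
  - apply Rle_trans with ((INR n + / 2) * (2 * / INR n / (2 + / INR n) *
      (1 + (/ INR n) ^ 2 / (12 * (1 + / INR n)))) - 1).
    + nra.
    + right. field. lra.
Qed.

Lemma stirling_defect_le (n m : nat) :
  (1 <= n <= m)%nat ->
  0 <= stirling_defect n - stirling_defect m
    <= 1 / (12 * INR n) - 1 / (12 * INR m).
Proof.
  intros [Hn Hm]. induction Hm as [| m Hm IH]; [lra |].
  pose proof (stirling_defect_step m ltac:(lia)). lra.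
Qed.

(** * Wallis integrals *)

Definition wallis_integral (n : nat) : R := RInt (fun x => sin x ^ n) 0 (PI / 2).

Lemma ex_RInt_sin_pow (n : nat) (a b : R) : ex_RInt (fun x => sin x ^ n) a b.
Proof.
  apply (ex_RInt_continuous (V := R_CompleteNormedModule)). intros x _.
  apply (ex_derive_continuous (V := R_NormedModule)). auto_derive. exact I.
Qed.

Lemma wallis_integral_0 : wallis_integral 0 = PI / 2.
Proof.
  unfold wallis_integral. simpl.
  rewrite (RInt_const (V := R_CompleteNormedModule)).
  unfold scal; simpl; unfold mult; simpl. ring.
Qed.

Lemma wallis_integral_1 : wallis_integral 1 = 1.
Proof.
  apply is_RInt_unique.
  replace 1 with (minus (- cos (PI / 2)) (- cos 0)).
  - apply (is_RInt_derive (V := R_CompleteNormedModule) (fun x => - cos x)).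
    + intros x _. auto_derive; [exact I | ring].
    + intros x _. apply (ex_derive_continuous (V := R_NormedModule)).
      auto_derive. exact I.
  - rewrite cos_PI2, cos_0. unfold minus, plus, opp; simpl. ring.
Qed.

(** The function - cos x sin^(n+1) x is a primitive of (n + 2) sin^(n+2) x - (n + 1) sin^n x and
    vanishes at both endpoints. *)
Lemma wallis_integral_rec (n : nat) :
  (INR n + 2) * wallis_integral (n + 2) = (INR n + 1) * wallis_integral n.
Proof.
  pose (df := fun x => (INR n + 2) * sin x ^ (n + 2) - (INR n + 1) * sin x ^ n).
  assert (H0 : is_RInt df 0 (PI / 2)
    (minus (- cos (PI / 2) * sin (PI / 2) ^ (n + 1)) (- cos 0 * sin 0 ^ (n + 1)))).
  { apply (is_RInt_derive (V := R_CompleteNormedModule)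
      (fun x => - cos x * sin x ^ (n + 1))).
    - intros x _. unfold df. auto_derive; [exact I |].
      replace (Init.Nat.pred (n + 1)) with n by lia.
      rewrite plus_INR, !pow_add. simpl.
      pose proof (sin2_cos2 x) as E. unfold Rsqr in E.
      transitivity (sin x ^ n * ((INR n + 2) * (sin x * sin x)
        - (INR n + 1) * (sin x * sin x + cos x * cos x))); [| rewrite E]; ring.
    - intros x _. apply (ex_derive_continuous (V := R_NormedModule)).
      unfold df. auto_derive. exact I. }
  assert (H1 : is_RInt df 0 (PI / 2)
    ((INR n + 2) * wallis_integral (n + 2) - (INR n + 1) * wallis_integral n)).
  { apply (is_RInt_minus (V := R_CompleteNormedModule));
      apply (is_RInt_scal (V := R_CompleteNormedModule));
      apply (RInt_correct (V := R_CompleteNormedModule)), ex_RInt_sin_pow. }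
  apply (is_RInt_unique (V := R_CompleteNormedModule)) in H0, H1.
  rewrite H0 in H1.
  rewrite cos_PI2, sin_0, pow_i in H1 by lia.
  unfold minus, plus, opp in H1; simpl in H1. lra.
Qed.

Lemma wallis_integral_decreasing (n : nat) :
  wallis_integral (S n) <= wallis_integral n.
Proof.
  apply RInt_le; try apply ex_RInt_sin_pow.
  - pose proof PI_RGT_0. lra.
  - intros x Hx.
    assert (0 <= sin x) by (apply sin_ge_0; lra).
    assert (0 <= sin x ^ n) by (apply pow_le; lra).
    pose proof (SIN_bound x). simpl. nra.
Qed.

(** By the recurrence the product does not depend on n; its value is read off at n = 0. *)
Lemma wallis_integral_mult_succ (n : nat) :
  (INR n + 1) * wallis_integral n * wallis_integral (S n) = PI / 2.
Proof.
  induction n as [| n IH].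
  - rewrite wallis_integral_0, wallis_integral_1. simpl. ring.
  - pose proof (wallis_integral_rec n) as E.
    replace (n + 2)%nat with (S (S n)) in E by lia.
    rewrite <- IH, S_INR.
    transitivity ((INR n + 2) * wallis_integral (S (S n)) * wallis_integral (S n));
      [ring |].
    rewrite E. ring.
Qed.

Lemma wallis_integral_even (n : nat) :
  wallis_integral (2 * n) = INR (fact (2 * n)) / (4 ^ n * INR (fact n) ^ 2) * (PI / 2).
Proof.
  induction n as [| n IH].
  - rewrite Nat.mul_0_r, wallis_integral_0. simpl. field.
  - pose proof (wallis_integral_rec (2 * n)) as E. rewrite IH in E.
    replace (2 * S n)%nat with (2 * n + 2)%nat by lia.
    pose proof (pos_INR n). pose proof (INR_fact_lt_0 n).
    assert (0 < 4 ^ n) by (apply pow_lt; lra).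
    assert (H2 : INR (2 * n) = 2 * INR n) by (rewrite mult_INR; reflexivity).
    replace (2 * n + 2)%nat with (S (S (2 * n))) in * by lia.
    rewrite H2 in E.
    rewrite !fact_simpl, !mult_INR, !S_INR, H2. simpl pow.
    apply (Rmult_eq_reg_l (2 * INR n + 2)); [| lra].
    rewrite E. simpl pow. field. repeat split; lra.
Qed.

(** In the product identities at 2n - 1 and 2n, monotonicity allows the odd-index factor to be
    replaced by the even-index one. *)
Lemma wallis_integral_even_bounds (n : nat) :
  (1 <= n)%nat ->
  0 < wallis_integral (2 * n) /\
  2 * INR n * wallis_integral (2 * n) ^ 2 <= PI / 2
    <= (2 * INR n + 1) * wallis_integral (2 * n) ^ 2.
Proof.
  intros Hn.
  assert (Hn1 : 1 <= INR n) by (apply (le_INR 1); lia).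
  assert (H2 : INR (2 * n) = 2 * INR n) by (rewrite mult_INR; reflexivity).
  assert (Hpos : 0 < wallis_integral (2 * n)).
  { rewrite wallis_integral_even. pose proof PI_RGT_0.
    pose proof (INR_fact_lt_0 n). pose proof (INR_fact_lt_0 (2 * n)).
    apply Rmult_lt_0_compat; [| lra]. apply Rdiv_lt_0_compat; [lra |].
    apply Rmult_lt_0_compat; apply pow_lt; lra. }
  split; [exact Hpos |].
  pose proof (wallis_integral_mult_succ (2 * n)) as E1.
  pose proof (wallis_integral_mult_succ (2 * n - 1)) as E2.
  pose proof (wallis_integral_decreasing (2 * n)) as D1.
  pose proof (wallis_integral_decreasing (2 * n - 1)) as D2.
  replace (S (2 * n - 1)) with (2 * n)%nat in E2, D2 by lia.
  rewrite minus_INR, H2 in E2 by lia. rewrite H2 in E1. simpl (INR 1) in E2.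
  rewrite <- E1 at 2. rewrite <- E2. rewrite <- !Rsqr_pow2. unfold Rsqr.
  split.
  - replace (2 * INR n - 1 + 1) with (2 * INR n) by ring.
    rewrite <- Rmult_assoc. apply Rmult_le_compat_r; [lra |].
    apply Rmult_le_compat_l; lra.
  - rewrite <- Rmult_assoc. apply Rmult_le_compat_l; [| lra].
    apply Rmult_le_pos; lra.
Qed.

(** * The limit of the Stirling defect *)

Lemma stirling_defect_double (n : nat) :
  (1 <= n)%nat ->
  ln (2 * PI) / 2 <= 2 * stirling_defect n - stirling_defect (2 * n)
    <= ln (2 * PI) / 2 + 1 / (4 * INR n).
Proof.
  intros Hn.
  assert (Hn1 : 1 <= INR n) by (apply (le_INR 1); lia).
  assert (H2 : INR (2 * n) = 2 * INR n) by (rewrite mult_INR; reflexivity).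
  pose proof PI_RGT_0 as HPI.
  pose proof (INR_fact_lt_0 n) as Hf. pose proof (INR_fact_lt_0 (2 * n)) as Hf2.
  destruct (wallis_integral_even_bounds n Hn) as [Hpos [Hup Hlow]].
  assert (Hpow : forall x m, 0 < x -> ln (x ^ m) = INR m * ln x).
  { intros x m Hx. rewrite <- Rpower_pow, ln_Rpower by exact Hx. reflexivity. }
  (* In the logarithm of the closed form, the terms of order n ln n and n cancel, leaving the two
     defects. *)
  assert (E : ln (wallis_integral (2 * n)) = stirling_defect (2 * n)
    - 2 * stirling_defect n + ln 2 / 2 - ln (INR n) / 2 + ln (PI / 2)).
  { assert (H4 : 0 < 4 ^ n) by (apply pow_lt; lra).
    assert (Hfs : 0 < INR (fact n) ^ 2) by (apply pow_lt; lra).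
    rewrite wallis_integral_even, ln_mult, ln_div, ln_mult, !Hpow;
      try lra; try (apply Rmult_lt_0_compat; lra).
    2: { apply Rdiv_lt_0_compat; [lra | apply Rmult_lt_0_compat; lra]. }
    replace (ln 4) with (2 * ln 2)
      by (replace 4 with (2 * 2) by ring; rewrite ln_mult by lra; ring).
    unfold stirling_defect. rewrite H2, ln_mult by lra. simpl (INR 2). field. }
  assert (Hsq : 0 < wallis_integral (2 * n) ^ 2) by (apply pow_lt; lra).
  apply ln_le in Hup; [| apply Rmult_lt_0_compat; lra].
  apply ln_le in Hlow; [| lra].
  rewrite ln_mult, Hpow, ln_mult in Hup by lra.
  rewrite ln_mult, Hpow in Hlow by lra.
  (* The two Wallis bounds now differ by ln (1 + 1/(2n)) <= 1/(2n); halving gives the error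
     1/(4n). *)
  replace (2 * INR n + 1) with (2 * INR n * (1 + / (2 * INR n))) in Hlow
    by (field; lra).
  assert (Hinv : 0 < / (2 * INR n)) by (apply Rinv_0_lt_compat; lra).
  rewrite !ln_mult in Hlow by lra.
  assert (Hln : ln (1 + / (2 * INR n)) <= / (2 * INR n)).
  { rewrite <- (ln_exp (/ (2 * INR n))) at 2.
    apply ln_le; [lra | apply exp_ineq1_le]. }
  rewrite ln_div in E, Hup, Hlow by lra. rewrite E in Hup, Hlow.
  simpl (INR 2) in Hup, Hlow. rewrite ln_mult by lra.
  replace (1 / (4 * INR n)) with (/ (2 * INR n) / 2) by (field; lra).
  split; lra.
Qed.

(** Stands in for a passage to the limit: some 1/m falls below any positive gap x - y. *)
Lemma le_of_le_add_inv (x y : R) (n : nat) :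
  (forall m, (1 <= m)%nat -> (n <= m)%nat -> x <= y + / INR m) -> x <= y.
Proof.
  intros H. apply Rnot_lt_le. intros Hxy.
  destruct (archimed_cor1 (x - y)) as [N [HN HN0]]; [lra |].
  specialize (H (max n N) ltac:(lia) ltac:(lia)).
  assert (/ INR (max n N) <= / INR N).
  { apply Rinv_le_contravar; [apply (lt_INR 0); lia | apply le_INR; lia]. }
  lra.
Qed.

(* The defects at m and 2m differ by O(1/m), so [stirling_defect_double] already
   locates the defect at m within O(1/m) of its limit. *)
Lemma stirling_defect_bounds (n : nat) :
  (1 <= n)%nat ->
  ln (2 * PI) / 2 <= stirling_defect n <= ln (2 * PI) / 2 + 1 / (12 * INR n).
Proof.
  intros Hn.
  assert (H : forall m, (1 <= m)%nat -> (n <= m)%nat ->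
    ln (2 * PI) / 2 <= stirling_defect n + / INR m /\
    stirling_defect n <= ln (2 * PI) / 2 + 1 / (12 * INR n) + / INR m).
  { intros m Hm Hnm.
    pose proof (stirling_defect_double m Hm) as H1.
    pose proof (stirling_defect_le m (2 * m) ltac:(lia)) as H2.
    pose proof (stirling_defect_le n m ltac:(lia)) as H3.
    assert (Hm1 : 1 <= INR m) by (apply (le_INR 1); lia).
    rewrite mult_INR in H2. change (INR 2) with 2 in H2.
    assert (0 < / INR m) by (apply Rinv_0_lt_compat; lra).
    replace (1 / (4 * INR m)) with (/ INR m / 4) in H1 by (field; lra).
    replace (1 / (12 * INR m)) with (/ INR m / 12) in H2, H3 by (field; lra).
    replace (1 / (12 * (2 * INR m))) with (/ INR m / 24) in H2 by (field; lra).
    split; lra. }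
  split; apply (le_of_le_add_inv _ _ n); intros m Hm Hnm; apply H; assumption.
Qed.

Theorem lemma8 (k : nat) (hk : (1 <= k)%nat) :
  sqrt (2 * PI) * exp (1 / (12 * INR k + 1) - 1 / (8 * INR k))
    / (6 * Rpower (INR k + 1) (3 / 2))
  <= Delta_int (k + 1)
  <= sqrt (2 * PI) * exp (1 / (12 * INR k)) / (6 * Rpower (INR k) (3 / 2)).
Proof.
  destruct (Delta_int_bounds k hk) as [Hlow Hup].
  assert (Hk1 : 1 <= INR k) by (apply (le_INR 1); lia).
  pose proof PI_RGT_0 as HPI. pose proof (INR_fact_lt_0 k) as Hf.
  assert (Hsqrt : sqrt (2 * PI) = exp (ln (2 * PI) / 2)).
  { rewrite <- Rpower_sqrt by lra. unfold Rpower. f_equal. field. }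
  assert (Hpow : forall x, 0 < x -> x ^ (k + 2) = exp ((INR k + 2) * ln x)).
  { intros x Hx. rewrite <- Rpower_pow, plus_INR by exact Hx. reflexivity. }
  rewrite Hpow in Hlow, Hup by lra.
  rewrite <- (exp_ln (INR (fact k)) Hf) in Hlow, Hup.
  (* With every factor written as an exponential, both bounds become linear inequalities between
     exponents. *)
  assert (Hexp : forall x y z, exp x * exp y / (6 * exp z) = exp (x + y - z) / 6).
  { intros x y z. unfold Rminus, Rdiv.
    rewrite !exp_plus, exp_Ropp, Rinv_mult. ring. }
  assert (Hexp' : forall x y z, exp x / 6 * (exp y / exp z) = exp (x + y - z) / 6).
  { intros x y z. rewrite <- Hexp. field. apply Rgt_not_eq, exp_pos. }
  rewrite Hexp' in Hlow, Hup. rewrite Hsqrt. unfold Rpower. rewrite !Hexp.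
  split; [eapply Rle_trans; [| exact Hlow] | eapply Rle_trans; [exact Hup |]];
    (apply Rmult_le_compat_r; [lra |]); apply exp_nondecreasing.
  - assert (1 / (12 * INR k + 1) - 1 / (8 * INR k) <= 0).
    { unfold Rdiv. rewrite !Rmult_1_l.
      enough (/ (12 * INR k + 1) <= / (8 * INR k)) by lra.
      apply Rinv_le_contravar; lra. }
    (* The defect is taken at k + 1, where ln (k+1)! = ln (k + 1) + ln k!; this produces the power
       3/2 of k + 1. *)
    destruct (stirling_defect_bounds (S k) ltac:(lia)) as [HS _].
    unfold stirling_defect in HS.
    rewrite fact_simpl, mult_INR, S_INR, (ln_mult (INR k + 1)) in HS by lra.
    lra.
  - destruct (stirling_defect_bounds k hk) as [_ HS].
    unfold stirling_defect in HS. lra.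
Qed.
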